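(* Let $\mathcal{V}$ and $\mathcal{F}$ be finite sets, let $f:\mathbb{R}^{\mathcal{V}}\to\mathbb{R}$ be a strongly convex, twice continuously differentiable function, and let $A\in\mathbb{R}^{\mathcal{F}\times\mathcal{V}}$. For $b\in\operatorname{Im}(A)$ let $x^\star(b):=\operatorname{argmin}\{f(x): x\in\mathbb{R}^{\mathcal{V}},\ Ax=b\}$ (the unique minimizer), let $\Sigma(b):=\nabla^2 f(x^\star(b))^{-1}$, and let $D(b):=\Sigma(b)A^T(A\Sigma(b)A^T)^{+}$. Then $x^\star$ is continuously differentiable along the subspace $\operatorname{Im}(A)$, and for every differentiable function $\varepsilon\in\mathbb{R}\mapsto b(\varepsilon)\in\operatorname{Im}(A)$ we have $$\frac{d x^\star(b(\varepsilon))}{d\varepsilon}=D(b(\varepsilon))\,\frac{d b(\varepsilon)}{d\varepsilon}.$$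
   Context: $\operatorname{Im}(A)=\{Ax: x\in\mathbb{R}^{\mathcal{V}}\}\subseteq\mathbb{R}^{\mathcal{F}}$. $M^T$ is the transpose and $M^{+}$ the Moore-Penrose pseudoinverse of a matrix $M$. ''Continuously differentiable along the subspace $\operatorname{Im}(A)$'' means that the map $x^\star:\operatorname{Im}(A)\to\mathbb{R}^{\mathcal{V}}$ is $C^1$ as a map defined on the finite-dimensional vector space $\operatorname{Im}(A)$. *)

(* Defs.v *)
From HB Require Import structures.
From mathcomp Require Import all_boot all_order all_algebra.
From mathcomp Require Import all_classical all_reals all_analysis.

Set Implicit Arguments.
Unset Strict Implicit.
Unset Printing Implicit Defensive.

Import Order.TTheory GRing.Theory Num.Theory.
Import numFieldNormedType.Exports.

Local Open Scope classical_set_scope.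
Local Open Scope ring_scope.

(* A finite set of cardinality n is identified with 'I_n, so that R^n is the
   type 'cV[R]_n of column vectors; n may be 0. *)

(* The four Penrose equations characterize the pseudoinverse among all
   n x m matrices (is_mp_pinv_uniq, mp_pinvP below). *)
Definition is_mp_pinv (R : realType) (m n : nat) (M : 'M[R]_(m, n))
    (X : 'M[R]_(n, m)) : Prop :=
  [/\ M *m X *m M = M, X *m M *m X = X,
      (M *m X)^T = M *m X & (X *m M)^T = X *m M].

Definition mp_pinv (R : realType) (m n : nat) (M : 'M[R]_(m, n)) :
  'M[R]_(n, m) := xget 0 [set X | is_mp_pinv M X].

Lemma is_mp_pinv_uniq (R : realType) (m n : nat) (M : 'M[R]_(m, n))
  (X Y : 'M[R]_(n, m)) : is_mp_pinv M X -> is_mp_pinv M Y -> X = Y.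
Proof.
move=> [X1 X2 X3 X4] [Y1 Y2 Y3 Y4].
have E1 : M *m X = M *m Y.
  have -> : M *m X = M *m Y *m (M *m X) by rewrite mulmxA Y1.
  by rewrite -[LHS]trmxK trmx_mul X3 Y3 mulmxA X1 Y3.
have E2 : X *m M = Y *m M.
  have -> : X *m M = X *m M *m (Y *m M) by rewrite -mulmxA (mulmxA M) Y1.
  by rewrite -[LHS]trmxK trmx_mul X4 Y4 -mulmxA (mulmxA M) X1 Y4.
by rewrite -X2 E2 -mulmxA E1 mulmxA Y2.
Qed.

Lemma gram_unit (R : realType) (m n : nat) (B : 'M[R]_(m, n)) :
  row_free B -> B *m B^T \in unitmx.
Proof.
move=> fB; rewrite -row_free_unit; apply: inj_row_free => v v0.
have uu0 : (v *m B) *m (v *m B)^T = 0.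
  by rewrite trmx_mul mulmxA -(mulmxA v) v0 mul0mx.
apply: (row_free_inj fB); rewrite mul0mx; apply/rowP => j; rewrite [RHS]mxE.
have /eqP := congr1 (fun N : 'M[R]_1 => N 0 0) uu0.
rewrite mxE [X in _ == X]mxE psumr_eq0; last first.
  by move=> i _; rewrite [X in _ * X]mxE -expr2 sqr_ge0.
move=> /allP /(_ j (mem_index_enum _)) /=.
by rewrite [X in _ * X]mxE mulf_eq0 orbb => /eqP.
Qed.

Lemma is_mp_pinv_fact (R : realType) (m n r : nat) (C : 'M[R]_(m, r))
  (B : 'M[R]_(r, n)) : row_full C -> row_free B ->
  is_mp_pinv (C *m B)
    (B^T *m invmx (B *m B^T) *m (invmx (C^T *m C) *m C^T)).
Proof.
move=> fC fB; have uB := gram_unit fB.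
have uC : C^T *m C \in unitmx.
  rewrite -{2}(trmxK C); apply: gram_unit.
  by rewrite /row_free mxrank_tr.
set G := invmx (B *m B^T); set H := invmx (C^T *m C); set X := B^T *m G *m (H *m C^T).
have GT : G^T = G by rewrite /G trmx_inv trmx_mul trmxK.
have HT : H^T = H by rewrite /H trmx_inv trmx_mul trmxK.
have BG : B *m (B^T *m G) = 1%:M by rewrite mulmxA mulmxV.
have HC : H *m C^T *m C = 1%:M by rewrite -mulmxA mulVmx.
have eMX : C *m B *m X = C *m (H *m C^T).
  by rewrite /X -(mulmxA C) (mulmxA B) BG mul1mx.
have eXM : X *m (C *m B) = B^T *m G *m B.
  by rewrite /X -[LHS]mulmxA (mulmxA (H *m _)) HC mul1mx.
split.
- by rewrite eMX -(mulmxA C) (mulmxA (H *m _)) HC mul1mx.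
- by rewrite eXM /X (mulmxA _ (B^T *m G)) -(mulmxA (B^T *m G) B) BG mulmx1.
- by rewrite eMX !trmx_mul trmxK HT mulmxA.
- by rewrite eXM !trmx_mul trmxK GT mulmxA.
Qed.

Lemma is_mp_pinv_ex (R : realType) (m n : nat) (M : 'M[R]_(m, n)) :
  exists X, is_mp_pinv M X.
Proof.
have := is_mp_pinv_fact (col_base_full M) (row_base_free M).
by rewrite mulmx_base => MX; eexists; exact: MX.
Qed.

Lemma mp_pinvP (R : realType) (m n : nat) (M : 'M[R]_(m, n)) :
  is_mp_pinv M (mp_pinv M).
Proof. by have [X MX] := is_mp_pinv_ex M; apply: (xgetPex 0 (ex_intro _ X MX)). Qed.

(* Strong convexity is relative to the Euclidean norm, which is not the
   library's norm on matrices (the sup norm). *)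
Definition strongly_convex (R : realType) (n : nat) (f : 'cV[R]_n -> R) : Prop :=
  exists2 mu : R, 0 < mu &
    forall (x y : 'cV[R]_n) (t : R), 0 <= t <= 1 ->
      f (t *: x + (1 - t) *: y) <=
        t * f x + (1 - t) * f y
        - mu / 2 * t * (1 - t) * \sum_(i < n) (x i 0 - y i 0) ^+ 2.

Definition gradient (R : realType) (n : nat) (f : 'cV[R]_n -> R)
    (x : 'cV[R]_n) : 'cV[R]_n :=
  \col_i 'D_(delta_mx i 0) f x.

Definition hessian (R : realType) (n : nat) (f : 'cV[R]_n -> R)
    (x : 'cV[R]_n) : 'M[R]_n :=
  \matrix_(i, j) 'D_(delta_mx j 0) (fun y => gradient f y i 0) x.

Definition twice_continuously_differentiable (R : realType) (n : nat)
    (f : 'cV[R]_n -> R) : Prop :=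
  [/\ forall x, differentiable f x,
      forall x, differentiable (gradient f) x
    & continuous (hessian f)].

Definition mximg (R : realType) (m n : nat) (A : 'M[R]_(m, n)) : set 'cV[R]_m :=
  range (fun x : 'cV[R]_n => A *m x).

Definition argmin (R : realType) (m n : nat) (f : 'cV[R]_n -> R)
    (A : 'M[R]_(m, n)) (b : 'cV[R]_m) : set 'cV[R]_n :=
  [set x | A *m x = b /\ forall y, A *m y = b -> f x <= f y].

(* Only meaningful for b in mximg A. *)
Definition xstar (R : realType) (m n : nat) (f : 'cV[R]_n -> R)
    (A : 'M[R]_(m, n)) (b : 'cV[R]_m) : 'cV[R]_n :=
  xget 0 (argmin f A b).

Definition Sigma (R : realType) (m n : nat) (f : 'cV[R]_n -> R)
    (A : 'M[R]_(m, n)) (b : 'cV[R]_m) : 'M[R]_n :=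
  invmx (hessian f (xstar f A b)).

Definition Dmx (R : realType) (m n : nat) (f : 'cV[R]_n -> R)
    (A : 'M[R]_(m, n)) (b : 'cV[R]_m) : 'M[R]_(n, m) :=
  Sigma f A b *m A^T *m mp_pinv (A *m Sigma f A b *m A^T).

(* g is C^1 as a map U -> R^n on the linear subspace U of R^m: at each point
   of U it has a Frechet derivative, a linear map U -> R^n, depending
   continuously on the point. A linear map on U is given by an n x m matrix;
   only its action on U is constrained, since c - b lies in U. Asking for
   continuity of the matrices themselves is no loss: composing with a fixed
   linear projection of R^m onto U extends any continuous family of linear maps
   on U to a continuous family of matrices. The values of g outside U are
   irrelevant. *)
Definition C1_along (R : realType) (m n : nat) (U : set 'cV[R]_m)
    (g : 'cV[R]_m -> 'cV[R]_n) : Prop :=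
  exists Dg : 'cV[R]_m -> 'M[R]_(n, m),
    {within U, continuous Dg} /\
    forall b, U b -> forall e : R, 0 < e ->
      \forall c \near within U (nbhs b),
        `|g c - g b - Dg b *m (c - b)| <= e * `|c - b|.

(* Main.v *)
(* The gradient of f is strongly monotone. Fix b in Im A, let H be the Hessian
   at x*(b) and, for c in Im A, let d = D(b)(c - b) and z = x*(b) + d. Then
   A z = c, so w = x*(c) - z lies in ker A, on which grad f(x*(b)),
   grad f(x*(c)) and H d all vanish. Strong monotonicity between z and x*(c)
   thus bounds |w| by the first-order remainder of grad f at x*(b), which is
   o(|c - b|): D(b) is the derivative of x* at b, without any appeal to the
   implicit function theorem. Continuity of D follows from a full-rank
   factorization of A, which turns the pseudoinverse into a genuine inverse. *)

Require Import Defs.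
From HB Require Import structures.
From mathcomp Require Import all_boot all_order all_algebra.
From mathcomp Require Import all_classical all_reals all_analysis.
From mathcomp Require Import ring lra.

Set Implicit Arguments.
Unset Strict Implicit.
Unset Printing Implicit Defensive.

Import Order.TTheory GRing.Theory Num.Theory.
Import numFieldNormedType.Exports.

Local Open Scope classical_set_scope.
Local Open Scope ring_scope.

(** * Limits of matrix products, determinants and inverses *)

Lemma cvg_mxP (R : realType) (T : Type) (F : set_system T) (m n : nat)
    (M : T -> 'M[R]_(m, n)) (L : 'M[R]_(m, n)) {FF : Filter F} :
  M @ F --> L <-> forall i j, M x i j @[x --> F] --> L i j.
Proof.
split=> [ML i j|ML].
  exact: (cvg_comp _ _ ML (@coord_continuous _ _ _ i j L)).
apply/cvgrPdist_le => e e0; near=> x.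
rewrite /Num.Def.normr/= mx_normrE (bigmax_le _ (ltW e0))//= => i _.
rewrite !mxE; move: i; near: x; apply: filter_forall => i.
exact: ((cvgrPdist_le _ _).1 (ML i.1 i.2)).
Unshelve. all: by end_near. Qed.

Lemma cvg_mulmx (R : realType) (T : Type) (F : set_system T) (m n p : nat)
    (M : T -> 'M[R]_(m, n)) (N : T -> 'M[R]_(n, p)) (K : 'M[R]_(m, n))
    (L : 'M[R]_(n, p)) {FF : Filter F} :
  M @ F --> K -> N @ F --> L -> M x *m N x @[x --> F] --> K *m L.
Proof.
move=> /cvg_mxP MK /cvg_mxP NL; apply/cvg_mxP => i j.
rewrite mxE; under eq_cvg do rewrite mxE.
apply: cvg_big => [|k _]; first exact: add_continuous.
by apply: cvgM; [exact: MK|exact: NL].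
Qed.

Lemma cvg_det (R : realType) (T : Type) (F : set_system T) (n : nat)
    (M : T -> 'M[R]_n) (L : 'M[R]_n) {FF : Filter F} :
  M @ F --> L -> \det (M x) @[x --> F] --> \det L.
Proof.
move=> /cvg_mxP ML; apply: cvg_big => [|s _]; first exact: add_continuous.
apply: cvgM; first exact: cvg_cst.
by apply: cvg_big => [|i _]; [exact: mul_continuous|exact: ML].
Qed.

(** By Cramer's rule the inverse is the adjugate divided by the determinant, both polynomial in the
    entries. Invertibility is asked of every [M x] because [invmx] returns a singular matrix
    unchanged. *)
Lemma cvg_invmx (R : realType) (T : Type) (F : set_system T) (n : nat)
    (M : T -> 'M[R]_n) (L : 'M[R]_n) {FF : Filter F} :
  L \in unitmx -> (forall x, M x \in unitmx) ->
  M @ F --> L -> invmx (M x) @[x --> F] --> invmx L.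
Proof.
move=> uL uM ML.
have inv_adj (N : 'M[R]_n) : N \in unitmx -> invmx N = (\det N)^-1 *: \adj N.
  by rewrite /invmx => ->.
rewrite inv_adj//; under eq_cvg do rewrite inv_adj//.
apply: cvgZ.
  apply: cvgV; first by rewrite -unitfE -unitmxE.
  exact: cvg_det.
apply/cvg_mxP => i j; rewrite mxE; under eq_cvg do rewrite mxE.
apply: cvgM; first exact: cvg_cst.
apply: cvg_det; apply/cvg_mxP => k l; rewrite !mxE.
under eq_cvg do rewrite !mxE.
by move/cvg_mxP : ML; exact.
Qed.

(** * Sup-norm estimates and the Euclidean inner product *)

Lemma coord_le_normr (R : realType) (m n : nat) (M : 'M[R]_(m, n)) i j :
  `|M i j| <= `|M|.
Proof.
by rewrite [leRHS]/Num.Def.normr/= mx_normrE; exact: (le_bigmax _ _ (i, j)).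
Qed.

Lemma normr_mx_le (R : realType) (m n : nat) (M : 'M[R]_(m, n)) (k : R) :
  0 <= k -> (forall i j, `|M i j| <= k) -> `|M| <= k.
Proof.
by move=> k0 Mk; rewrite [leLHS]/Num.Def.normr/= mx_normrE bigmax_le.
Qed.

Lemma normr_trmx (R : realType) (m n : nat) (M : 'M[R]_(m, n)) : `|M^T| = `|M|.
Proof.
have le_tr p q (N : 'M[R]_(p, q)) : `|N^T| <= `|N|.
  by apply: normr_mx_le => // i j; rewrite mxE coord_le_normr.
by apply/le_anti; rewrite le_tr -{1}(trmxK M) le_tr.
Qed.

Lemma normr_mulmx_le (R : realType) (m n p : nat) (M : 'M[R]_(m, n))
  (N : 'M[R]_(n, p)) : `|M *m N| <= n%:R * `|M| * `|N|.
Proof.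
apply: normr_mx_le => [|i j]; first by rewrite !mulr_ge0.
rewrite mxE (le_trans (ler_norm_sum _ _ _))//.
have -> : n%:R * `|M| * `|N| = \sum_(k < n) `|M| * `|N|.
  by rewrite sumr_const card_ord -mulrA mulr_natl.
by apply: ler_sum => k _; rewrite normrM ler_pM// coord_le_normr.
Qed.

Definition dot (R : realType) (n : nat) (u v : 'cV[R]_n) : R := (u^T *m v) 0 0.

Section dot.
Variables (R : realType) (n : nat).
Implicit Types u v w : 'cV[R]_n.

Lemma dotE u v : dot u v = \sum_i u i 0 * v i 0.
Proof. by rewrite /dot mxE; apply: eq_bigr => i _; rewrite mxE. Qed.

Lemma dotC u v : dot u v = dot v u.
Proof. by rewrite !dotE; apply: eq_bigr => i _; rewrite mulrC. Qed.

Lemma dotBl u v w : dot (u - v) w = dot u w - dot v w.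
Proof. by rewrite /dot linearB mulmxBl !mxE. Qed.

Lemma dotNr u v : dot u (- v) = - dot u v.
Proof. by rewrite /dot mulmxN mxE. Qed.

Lemma dotNl u v : dot (- u) v = - dot u v.
Proof. by rewrite dotC dotNr dotC. Qed.

Lemma dotZr k u v : dot u (k *: v) = k * dot u v.
Proof. by rewrite /dot -scalemxAr mxE. Qed.

Lemma dotZl k u v : dot (k *: u) v = k * dot u v.
Proof. by rewrite dotC dotZr dotC. Qed.

Lemma dot_le_norm u v : `|dot u v| <= n%:R * `|u| * `|v|.
Proof.
rewrite -(normr_trmx u); apply: le_trans (normr_mulmx_le _ _).
exact: coord_le_normr.
Qed.

(** The sup norm is attained at some entry, whose square is one of the terms of the sum. Estimates
    in the Euclidean square, the form given by strong convexity, pass to the sup norm this way. *)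
Lemma normsq_le_dot v : `|v| ^+ 2 <= dot v v.
Proof.
have sq_ge0 i : 0 <= v i 0 * v i 0 by rewrite -expr2 sqr_ge0.
have [v0|/mx_norm_neq0[[i j]/= iE]] := eqVneq `|v| 0.
  by rewrite v0 expr0n/= dotE sumr_ge0.
rewrite /Num.Def.normr/= iE ord1 real_normK ?num_real// dotE (bigD1 i)//=.
by rewrite -expr2 lerDl sumr_ge0.
Qed.

End dot.

(** * Differentials expressed by the gradient and the Hessian *)

Lemma gradientE (R : realType) (n : nat) (f : 'cV[R]_n -> R) (x v : 'cV[R]_n) :
  differentiable f x -> 'D_v f x = dot (gradient f x) v.
Proof.
move=> df; rewrite deriveE// {1}(matrix_sum_delta v) dotE linear_sum.
apply: eq_bigr => i _; rewrite big_ord1 linearZ/= mulrC mxE.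
by rewrite [in RHS]deriveE.
Qed.

Lemma hessianE (R : realType) (n : nat) (f : 'cV[R]_n -> R) (x v : 'cV[R]_n) :
  differentiable (gradient f) x -> 'd (gradient f) x v = hessian f x *m v.
Proof.
move=> df; rewrite {1}(matrix_sum_delta v) linear_sum.
apply/colP => i; rewrite summxE mxE.
apply: eq_bigr => j _; rewrite big_ord1 linearZ/= mxE mulrC mxE; congr (_ * _).
rewrite -deriveE// derive_mx ?mxE//; exact: diff_derivable.
Qed.

(** Inequalities will be divided by the step [h], so only positive steps are kept. *)
Lemma cvg_derive_right (R : realType) (V W : normedModType R) (f : V -> W)
    (x v : V) : derivable f x v ->
  h^-1 *: (f (h *: v + x) - f x) @[h --> 0^'+] --> 'D_v f x.
Proof. by move=> df; apply: cvg_dnbhs_at_right; exact: df. Qed.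

(** * First- and second-order consequences of strong convexity *)

Section strongly_convex_gradient.
Variables (R : realType) (n : nat) (f : 'cV[R]_n -> R) (mu : R).
Hypothesis mu0 : 0 < mu.
Hypothesis f_convex : forall (x y : 'cV[R]_n) (t : R), 0 <= t <= 1 ->
  f (t *: x + (1 - t) *: y) <=
    t * f x + (1 - t) * f y
    - mu / 2 * t * (1 - t) * \sum_(i < n) (x i 0 - y i 0) ^+ 2.
Hypothesis df : forall x, differentiable f x.

(** Apply strong convexity at [h *: y + (1 - h) *: x], subtract [f x], divide by [h] and let [h]
    decrease to 0. *)
Lemma strongly_convex_ge (x y : 'cV[R]_n) :
  f x + dot (gradient f x) (y - x) + mu / 2 * dot (y - x) (y - x) <= f y.
Proof.
set v := y - x; set q := dot v v.
(* The factor [1 - 0] is the limit of the factor [1 - h] below. *)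
suff : 'D_v f x + mu / 2 * (1 - 0) * q <= f y - f x.
  by rewrite gradientE//; lra.
apply: (@cvgr_to_le _ (0 : R)^'+ _ _
  (fun h => h^-1 *: (f (h *: v + x) - f x) + mu / 2 * (1 - h) * q)).
  apply: cvgD; first exact/cvg_derive_right/diff_derivable.
  apply: cvgM; last exact: cvg_cst.
  apply: cvgM; first exact: cvg_cst.
  apply: cvgB; first exact: cvg_cst.
  by apply: cvg_at_right_filter; exact: cvg_id.
near=> h.
have h0 : 0 < h by near: h; exact: nbhs_right_gt.
have h1 : h <= 1 by near: h; exact: nbhs_right_ltW.
have := @f_convex y x h; rewrite h1 ltW// => /(_ isT).
have -> : \sum_(i < n) (y i 0 - x i 0) ^+ 2 = q.
  by rewrite /q dotE; apply: eq_bigr => i _; rewrite !mxE -expr2.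
have -> : h *: y + (1 - h) *: x = h *: v + x.
  by rewrite /v scalerBr scalerBl scale1r addrA addrAC.
move=> fh; rewrite -lerBrDr ler_pdivrMl//.
by nra.
Unshelve. all: by end_near. Qed.

(** Add the quadratic lower bounds from [x] to [y] and from [y] to [x]: the values of [f] cancel. *)
Lemma gradient_strongly_monotone (x y : 'cV[R]_n) :
  mu * dot (y - x) (y - x) <= dot (gradient f y - gradient f x) (y - x).
Proof.
have := strongly_convex_ge x y; have := strongly_convex_ge y x.
have -> : x - y = - (y - x) by rewrite opprB.
by set v := y - x; rewrite !(dotNl, dotNr) dotBl; lra.
Qed.

(** Strong monotonicity between [x] and [h *: v + x], divided by the square of [h], becomes this
    bound in the limit. *)
Lemma hessian_coercive (x v : 'cV[R]_n) : differentiable (gradient f) x ->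
  mu * dot v v <= dot (hessian f x *m v) v.
Proof.
move=> dg; rewrite -hessianE// -deriveE//.
apply: (@cvgr_to_ge _ (0 : R)^'+ _ _
  (fun h => dot (h^-1 *: (gradient f (h *: v + x) - gradient f x)) v)).
  have /cvg_mxP gv := @cvg_derive_right _ _ _ _ x v (diff_derivable dg).
  rewrite dotE; under eq_cvg do rewrite dotE.
  apply: cvg_big => [|i _]; first exact: add_continuous.
  by apply: cvgM; [exact: gv|exact: cvg_cst].
near=> h.
have h0 : 0 < h by near: h; exact: nbhs_right_gt.
have := gradient_strongly_monotone x (h *: v + x).
rewrite addrK dotZl !dotZr dotZl ler_pdivlMl//.
by move=> H; rewrite -(ler_pM2l h0); lra.
Unshelve. all: by end_near. Qed.

(** Coercivity leaves only 0 in the kernel. [row_free] tests row vectors, hence the transposes. *)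
Lemma hessian_unit (x : 'cV[R]_n) : differentiable (gradient f) x ->
  hessian f x \in unitmx.
Proof.
move=> dg; rewrite -unitmx_tr -row_free_unit; apply: inj_row_free => v v0.
have Hv : hessian f x *m v^T = 0 by rewrite -[LHS]trmxK trmx_mul trmxK v0 trmx0.
have := hessian_coercive v^T dg; rewrite Hv {2}/dot trmx0 mul0mx mxE.
have := normsq_le_dot v^T; rewrite -(ler_pM2l mu0) => /le_trans h /h.
rewrite pmulr_rle0// exprn_even_le0//= normr_eq0 => /eqP vT0.
by rewrite -[v]trmxK vT0 trmx0.
Qed.

End strongly_convex_gradient.

(** * Constrained minimizers: first-order condition, existence and uniqueness *)

(** Moving from [x] along the kernel of [A] keeps the constraint, so the directional derivative is
    nonnegative there; [v] and [- v] both qualify. *)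
Lemma argmin_gradient (R : realType) (m n : nat) (f : 'cV[R]_n -> R)
    (A : 'M[R]_(m, n)) (b : 'cV[R]_m) (x v : 'cV[R]_n) :
  differentiable f x -> argmin f A b x -> A *m v = 0 ->
  dot (gradient f x) v = 0.
Proof.
move=> df [Axb xmin] Av0.
have ge0 w : A *m w = 0 -> 0 <= dot (gradient f x) w.
  move=> Aw0; rewrite -gradientE//.
  apply: (@cvgr_to_ge _ (0 : R)^'+ _ _
    (fun h => h^-1 *: (f (h *: w + x) - f x))).
    exact: (@cvg_derive_right _ _ _ _ x w (diff_derivable df)).
  near=> h; have h0 : 0 < h by near: h; exact: nbhs_right_gt.
  rewrite pmulr_rge0 ?invr_gt0// subr_ge0 xmin//.
  by rewrite mulmxDr -scalemxAr Aw0 scaler0 add0r.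
apply/le_anti; rewrite ge0// andbT -oppr_ge0 -dotNr.
by apply: ge0; rewrite mulmxN Av0 oppr0.
Unshelve. all: by end_near. Qed.

Section constrained_minimizer.
Variables (R : realType) (m n : nat) (f : 'cV[R]_n -> R) (A : 'M[R]_(m, n)).
Hypothesis df : forall x, differentiable f x.

(** Far from a feasible point [x0] the quadratic lower bound pushes [f] above [f x0]; the remaining
    feasible points form a compact set, on which [f] attains its minimum. *)
Lemma strongly_convex_argmin_ex (b : 'cV[R]_m) : strongly_convex f ->
  mximg A b -> exists x, argmin f A b x.
Proof.
move=> [mu mu0 fc] [x0 _ Ax0].
(* Beyond distance [K] the quadratic term, at least [mu / 2] times the squared distance, outweighs
   the linear one, at most [n%:R] times the norm of [g] times the distance. *)
pose g := gradient f x0; pose K := 2 * n%:R * `|g| / mu.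
have K0 : 0 <= K by rewrite /K !mulr_ge0// invr_ge0 ltW.
have far y : K < `|y - x0| -> f x0 < f y.
  move=> Ky; have y0 : 0 < `|y - x0| by apply: le_lt_trans Ky.
  have := strongly_convex_ge fc df x0 y; apply: lt_le_trans.
  have := dot_le_norm g (y - x0); have := normsq_le_dot (y - x0).
  move: Ky; rewrite /K ltr_pdivrMr// ler_norml -/g.
  set d := `|y - x0| in y0 *; set p := dot g _; set q := dot _ _; set c := `|g|.
  move=> Ky dq /andP[p1 _].
  have mdq : mu * d ^+ 2 <= mu * q by rewrite ler_pM2l.
  have : 2 * n%:R * c * d < d * mu * d by rewrite ltr_pM2r.
  by rewrite expr2 in mdq; lra.
(* Points are transposed to row vectors, as [EVT_min_rV] takes them. The constraint is written as a
   norm at most 0, so that [S] is an intersection of preimages of closed half-lines. *)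
pose S := [set v : 'rV[R]_n | `|A *m v^T - b| <= 0] `&`
          [set v : 'rV[R]_n | `|v - x0^T| <= K].
have Sx0 : S x0^T by rewrite /S/= trmxK Ax0 !subrr !normr0.
have cT (F : set_system 'rV[R]_n) (v : 'rV[R]_n) :
    Filter F -> F --> v -> w^T @[w --> F] --> v^T.
  move=> FF /cvg_mxP Fv; apply/cvg_mxP => i j; rewrite mxE.
  by under eq_cvg do rewrite mxE; exact: Fv.
have cA (F : set_system 'rV[R]_n) (v : 'rV[R]_n) : Filter F -> F --> v ->
    `|A *m w^T - b| @[w --> F] --> `|A *m v^T - b|.
  move=> FF Fv; apply: cvg_norm; apply: cvgB; last exact: cvg_cst.
  by apply: cvg_mulmx; [exact: cvg_cst|exact: cT].
have cx (F : set_system 'rV[R]_n) (v : 'rV[R]_n) : Filter F -> F --> v ->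
    `|w - x0^T| @[w --> F] --> `|v - x0^T|.
  by move=> FF Fv; apply: cvg_norm; apply: cvgB; [exact: Fv|exact: cvg_cst].
have compS : compact S.
  apply: bounded_closed_compact.
    exists (K + `|x0^T|); split; first exact: num_real.
    move=> r Kr v [_ vK]; apply: le_trans (ltW Kr).
    by rewrite -lerBlDr; apply: le_trans (lerB_dist _ _) vK.
  apply: closedI.
    apply: (@closed_comp _ _ (fun v : 'rV[R]_n => `|A *m v^T - b|)
      [set r | r <= 0]); last exact: closed_le.
    by move=> v _; exact: (cA (nbhs v) v (nbhs_filter v)).
  apply: (@closed_comp _ _ (fun v : 'rV[R]_n => `|v - x0^T|)
    [set r | r <= K]); last exact: closed_le.
  by move=> v _; exact: (cx (nbhs v) v (nbhs_filter v)).
have [||v /set_mem[Av vK] vmin] :=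
  @EVT_min_rV R n (fun v => f v^T) S _ compS.
- by exists x0^T.
- apply: continuous_subspaceT => v.
  apply: (@cvg_comp _ _ _ trmx f _ (nbhs v^T)); first exact: (cT (nbhs v) v (nbhs_filter v)).
  exact: (differentiable_continuous (df v^T)).
exists v^T; split.
  by apply/eqP; rewrite -subr_eq0 -normr_le0.
move=> y Ayb; have [yK|/far fy] := leP `|y - x0| K.
  rewrite -[y]trmxK; apply: vmin; apply/mem_set; split=> /=.
    by rewrite trmxK Ayb subrr normr0.
  by rewrite -linearB normr_trmx.
(* Outside the ball [f y] exceeds [f x0], and [x0] itself lies in [S]. *)
apply: le_trans (ltW fy); rewrite -[x0]trmxK; apply: vmin; exact/mem_set.
Qed.

(** [y - x] lies in the kernel of [A], so the linear term at [x] vanishes and the quadratic term is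
    at most [f y - f x], which is at most 0. *)
Lemma strongly_convex_argmin_uniq (b : 'cV[R]_m) (x y : 'cV[R]_n) :
  strongly_convex f -> argmin f A b x -> argmin f A b y -> x = y.
Proof.
move=> [mu mu0 fc] xmin ymin; have [Ax xle] := xmin; have [Ay yle] := ymin.
have := strongly_convex_ge fc df x y.
rewrite (argmin_gradient (df x) xmin) ?mulmxBr ?Ax ?Ay ?subrr// addr0.
move=> /le_trans /(_ (yle _ Ax)); rewrite gerDl pmulr_rle0 ?divr_gt0//.
move=> /(le_trans (normsq_le_dot _)).
by rewrite exprn_even_le0//= normr_eq0 subr_eq0 => /eqP.
Qed.

Lemma xstar_argmin (b : 'cV[R]_m) : strongly_convex f ->
  mximg A b -> argmin f A b (xstar f A b).
Proof.
move=> fc /(strongly_convex_argmin_ex fc)[x xP].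
exact: (xgetPex 0 (ex_intro _ x xP)).
Qed.

End constrained_minimizer.

(** * The pseudoinverse through a full-rank factorization *)

(* For A = C B with CL a left inverse of C, the matrix S A^T (A S A^T)^+ equals
   S B^T (B S B^T)^-1 CL, which involves no pseudoinverse and hence depends
   continuously on S. *)
Section factored_pinv.
Variables (R : realType) (m n r : nat) (A : 'M[R]_(m, n)).
Variables (C : 'M[R]_(m, r)) (B : 'M[R]_(r, n)) (CL : 'M[R]_(r, m)).
Hypotheses (AE : A = C *m B) (fB : row_free B).
Hypotheses (CLK : CL *m C = 1%:M) (C_CLT : (C *m CL)^T = C *m CL).

Lemma right_factor_mulmx0 p (v : 'M[R]_(n, p)) : A *m v = 0 -> B *m v = 0.
Proof.
by move=> Av0; rewrite -[LHS]mul1mx -CLK -mulmxA (mulmxA C) -AE Av0 mulmx0.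
Qed.

(** If [w] is in the left kernel, then [u], the image under [invmx H] of the transpose of [w *m B],
    satisfies [dot (H *m u) u = 0]. Positivity gives [u = 0], hence [w *m B = 0], and [B] is
    row-free. *)
Lemma right_factor_form_unit (H : 'M[R]_n) : H \in unitmx ->
  (forall v, v != 0 -> 0 < dot (H *m v) v) ->
  B *m invmx H *m B^T \in unitmx.
Proof.
move=> uH Hpos; rewrite -row_free_unit; apply: inj_row_free => w w0.
set u := invmx H *m (w *m B)^T.
have Hu : H *m u = (w *m B)^T by rewrite mulKVmx.
have uu0 : dot (H *m u) u = 0.
  have wB : w *m B *m invmx H *m B^T = 0 by rewrite -w0 !mulmxA.
  by rewrite Hu /dot trmxK /u trmx_mul !mulmxA wB mul0mx mxE.
have u0 : u = 0 by apply/eqP/negPn/negP => /Hpos; rewrite uu0 ltxx.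
apply: (row_free_inj fB); rewrite mul0mx.
by rewrite -[LHS]trmxK -Hu u0 mulmx0 trmx0.
Qed.

Definition pinv_factored (S : 'M[R]_n) : 'M[R]_(n, m) :=
  S *m B^T *m invmx (B *m S *m B^T) *m CL.

Lemma mp_pinv_factored (S : 'M[R]_n) :
  B *m S *m B^T \in unitmx ->
  S *m A^T *m mp_pinv (A *m S *m A^T) = pinv_factored S.
Proof.
rewrite /pinv_factored => uG.
have CLT : C^T *m CL^T = 1%:M by rewrite -trmx_mul CLK trmx1.
have [G GE] : exists G, G = B *m S *m B^T by eexists.
rewrite -GE in uG *.
have ME : A *m S *m A^T = C *m G *m C^T by rewrite AE trmx_mul GE !mulmxA.
(* The candidate inverts each factor of [C *m G *m C^T]. Its products with that matrix on either
   side are both [C *m CL], the orthogonal projection onto the image of [A], from which the four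
   Penrose equations follow. *)
pose X := CL^T *m invmx G *m CL.
have MX : C *m G *m C^T *m X = C *m CL.
  by rewrite /X -!mulmxA (mulmxA C^T) CLT mul1mx (mulmxA G) mulmxV// mul1mx.
have XM : X *m (C *m G *m C^T) = C *m CL.
  rewrite /X -!mulmxA (mulmxA CL) CLK mul1mx (mulmxA (invmx G)) mulVmx// mul1mx.
  by rewrite -trmx_mul C_CLT.
have -> : mp_pinv (A *m S *m A^T) = X.
  apply: is_mp_pinv_uniq (mp_pinvP _) _; rewrite ME; split.
  - by rewrite MX -!mulmxA (mulmxA CL) CLK mul1mx.
  - by rewrite XM -C_CLT trmx_mul /X !mulmxA -(mulmxA CL^T C^T) CLT mulmx1.
  - by rewrite MX C_CLT.
  - by rewrite XM C_CLT.
rewrite {1}AE trmx_mul /X !mulmxA; congr (_ *m _).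
by rewrite -!mulmxA (mulmxA C^T) CLT mul1mx !mulmxA.
Qed.

(** The inverse cancels, leaving [C *m CL], which fixes the image of [A]. Hence a step [D(b)(c - b)]
    from a point feasible for [b] reaches one feasible for [c]. *)
Lemma pinv_factored_right_inv (S : 'M[R]_n) (u : 'cV[R]_m) :
  B *m S *m B^T \in unitmx -> mximg A u ->
  A *m (pinv_factored S *m u) = u.
Proof.
rewrite /pinv_factored => uG [x _ <-]; set K := invmx _.
have GK : B *m S *m B^T *m K = 1%:M by rewrite mulmxV.
transitivity (C *m (B *m S *m B^T *m K) *m (CL *m (A *m x))).
  by rewrite {1}AE !mulmxA.
by rewrite GK mulmx1 AE -(mulmxA C) (mulmxA CL) CLK mul1mx.
Qed.

(** [H] cancels its inverse and leaves a vector in the range of [B^T], which is orthogonal to the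
    kernel of [B]. *)
Lemma pinv_factored_orth (H : 'M[R]_n) (u : 'cV[R]_m) (v : 'cV[R]_n) :
  H \in unitmx -> A *m v = 0 ->
  dot (H *m (pinv_factored (invmx H) *m u)) v = 0.
Proof.
move=> uH /right_factor_mulmx0 Bv0; rewrite /pinv_factored -!mulmxA mulKVmx//.
by rewrite /dot trmx_mul trmxK -mulmxA Bv0 mulmx0 mxE.
Qed.

Lemma cvg_pinv_factored (T : Type) (F : set_system T) (S : T -> 'M[R]_n)
    (L : 'M[R]_n) {FF : Filter F} :
  B *m L *m B^T \in unitmx ->
  (forall t, B *m S t *m B^T \in unitmx) ->
  S @ F --> L -> pinv_factored (S t) @[t --> F] --> pinv_factored L.
Proof.
move=> uL uS SL; apply: cvg_mulmx; last exact: cvg_cst.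
apply: cvg_mulmx; first by apply: cvg_mulmx; [exact: SL|exact: cvg_cst].
apply: cvg_invmx => //; apply: cvg_mulmx; last exact: cvg_cst.
by apply: cvg_mulmx; [exact: cvg_cst|exact: SL].
Qed.

End factored_pinv.

(** * Differentiability of the minimizer along the image of [A] *)

Lemma differentiable_remainder (R : realType) (V W : normedModType R)
    (f : V -> W) (x : V) (e : R) : differentiable f x -> 0 < e ->
  \forall d \near (0 : V), `|f (x + d) - f x - 'd f x d| <= e * `|d|.
Proof.
move=> /diff_locallyP[_ /eqaddoP] /(_ e) fx e0.
have := fx e0; apply: filterS => d.
by rewrite [x + d]addrC -addrA -opprD; exact.
Qed.

Section xstar_derivative.
Variables (R : realType) (m n r : nat) (f : 'cV[R]_n -> R) (A : 'M[R]_(m, n)).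
Variables (C : 'M[R]_(m, r)) (B : 'M[R]_(r, n)) (CL : 'M[R]_(r, m)).
Hypotheses (AE : A = C *m B) (fB : row_free B).
Hypotheses (CLK : CL *m C = 1%:M) (C_CLT : (C *m CL)^T = C *m CL).
Hypothesis f_convex : strongly_convex f.
Hypothesis df : forall x, differentiable f x.
Hypothesis dg : forall x, differentiable (gradient f) x.
Hypothesis cH : continuous (hessian f).

Let unit_hessian x : hessian f x \in unitmx.
Proof. by have [mu mu0 fc] := f_convex; exact: hessian_unit mu0 fc df _ (dg x). Qed.

Let form_unit x : B *m invmx (hessian f x) *m B^T \in unitmx.
Proof.
have [mu mu0 fc] := f_convex; apply: right_factor_form_unit => // v v0.
apply: lt_le_trans (hessian_coercive fc df v (dg x)).
rewrite pmulr_rgt0//; apply: lt_le_trans (normsq_le_dot v).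
by rewrite exprn_gt0// normr_gt0.
Qed.

Lemma Dmx_factored b : Dmx f A b = pinv_factored B CL (Sigma f A b).
Proof. exact: mp_pinv_factored AE CLK C_CLT _ (form_unit _). Qed.

Lemma xstar_remainder (b : 'cV[R]_m) (e : R) : mximg A b -> 0 < e ->
  \forall c \near within (mximg A) (nbhs b),
    `|xstar f A c - xstar f A b - Dmx f A b *m (c - b)| <= e * `|c - b|.
Proof.
move=> Ab e0; have [mu mu0 fc] := f_convex.
set D := Dmx f A b; set x := xstar f A b.
have [K K0 DK] : exists2 K, 0 <= K & forall u : 'cV[R]_m, `|D *m u| <= K * `|u|.
  by exists (m%:R * `|D|) => [|u]; [rewrite mulr_ge0|exact: normr_mulmx_le].
have nK0 : 0 < n%:R * K + 1 by rewrite ltr_wpDl// mulr_ge0.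
(* [e'] is the tolerance for the remainder [p] of the gradient. The bounds at the end chain [mu]
   times the norm of [w] to [n%:R * (e' * K)] times that of [c - b]; the [+ 1] keeps the denominator
   positive. *)
have [e' e'0 e'K] : exists2 e', 0 < e' & n%:R * (e' * K) <= mu * e.
  exists (mu * e / (n%:R * K + 1)); first by rewrite !mulr_gt0// invr_gt0.
  have -> : n%:R * (mu * e / (n%:R * K + 1) * K) =
            (mu * e) * (n%:R * K / (n%:R * K + 1)).
    by field; rewrite gt_eqF.
  apply: ler_piMr; first by rewrite mulr_ge0// ltW.
  by rewrite ler_pdivrMr// mul1r lerDl.
have D0 (F : set_system 'cV[R]_m) : Filter F -> F --> b ->
    D *m (c - b) @[c --> F] --> (0 : 'cV[R]_n).
  move=> FF Fb; rewrite -(mulmx0 _ D) -(subrr b).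
  by apply: cvg_mulmx; [exact: cvg_cst|apply: cvgB; [exact: Fb|exact: cvg_cst]].
(* The remainder bound near 0 is pulled back along [c] to [D *m (c - b)], which tends to 0 as [c]
   tends to [b]. *)
have := D0 _ (nbhs_filter b) (@cvg_id _ _) _ (differentiable_remainder (dg x) e'0).
rewrite near_withinE; apply: (@filterS _ (nbhs b) (nbhs_filter b)) => c; rewrite /= hessianE//.
set d := D *m (c - b) => rem Ac; set y := xstar f A c.
have [xmin ymin] := (xstar_argmin df f_convex Ab, xstar_argmin df f_convex Ac).
have [[Ax _] [Ay _]] := (xmin, ymin).
have Acb : mximg A (c - b).
  by move: Ac Ab => [u _ <-] [v _ <-]; exists (u - v) => //; rewrite mulmxBr.
have Ad : A *m d = c - b.
  by rewrite /d /D Dmx_factored (pinv_factored_right_inv AE CLK (form_unit _)).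
set w := y - x - d.
have Aw : A *m w = 0 by rewrite /w !mulmxBr Ax Ay Ad subrr.
have Hdw : dot (hessian f x *m d) w = 0.
  by rewrite /d /D Dmx_factored (pinv_factored_orth AE CLK _ (unit_hessian _)).
have := gradient_strongly_monotone fc df (x + d) y.
have -> : y - (x + d) = w by rewrite opprD addrA.
set p := gradient f (x + d) - gradient f x - hessian f x *m d in rem *.
(* The gradients at the minimizers [x] and [y] and the vector [hessian f x *m d] are all orthogonal
   to [w], so only [p] survives. *)
have -> : dot (gradient f y - gradient f (x + d)) w = - dot p w.
  rewrite /p !dotBl Hdw (argmin_gradient (df _) ymin)//.
  by rewrite (argmin_gradient (df _) xmin)//; ring.
move=> mono.
have w_le : mu * `|w| ^+ 2 <= n%:R * `|p| * `|w|.
  apply: (le_trans _ (dot_le_norm p w)); rewrite -(normrN (dot p w)).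
  apply: le_trans _ (ler_norm (- dot p w)); apply: le_trans _ mono.
  by rewrite ler_pM2l// normsq_le_dot.
have d_le : `|d| <= K * `|c - b| by exact: DK.
(* The bound is quadratic in the norm of [w] on the left and linear on the right; one factor is
   cancelled when it is nonzero. *)
have [w0|w0] := eqVneq `|w| 0; first by rewrite w0 mulr_ge0// ltW.
have {w_le} mw : mu * `|w| <= n%:R * `|p|.
  by rewrite expr2 mulrA ler_pM2r ?lt_def ?w0//= in w_le.
rewrite -(ler_pM2l mu0); apply: (le_trans mw); rewrite mulrA.
apply: le_trans _ (ler_wpM2r (normr_ge0 (c - b)) e'K); rewrite -!mulrA ler_wpM2l//.
by apply: (le_trans rem); rewrite ler_wpM2l// ltW.
Qed.

(** The remainder estimate with [e = 1] bounds the increment of [xstar f A] by [K] times that of the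
    argument. *)
Lemma xstar_cvg (b : 'cV[R]_m) : mximg A b ->
  xstar f A c @[c --> within (mximg A) (nbhs b)] --> xstar f A b.
Proof.
move=> Ab; set D := Dmx f A b; pose K := m%:R * `|D| + 1.
have K0 : 0 < K by rewrite /K ltr_wpDl// mulr_ge0.
apply/cvgrPdist_le => e e0.
have eK0 : 0 < e / K by rewrite divr_gt0.
have cb : \forall c \near nbhs b, `|b - c| <= e / K.
  by have /cvgrPdist_le/(_ _ eK0) := @cvg_id _ (nbhs b).
near=> c.
have cbK : `|c - b| <= e / K.
  by rewrite distrC; near: c; apply: cvg_within; exact: cb.
have xcb : `|xstar f A c - xstar f A b - D *m (c - b)| <= 1 * `|c - b|.
  by near: c; exact: xstar_remainder.
rewrite distrC -[X in `|X|](subrK (D *m (c - b))).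
apply: le_trans (ler_normD _ _) _; apply: (@le_trans _ _ (K * `|c - b|)).
  by rewrite /K mulrDl addrC lerD// normr_mulmx_le.
by rewrite mulrC -ler_pdivlMr.
Unshelve. all: by end_near. Qed.

Lemma xstar_C1 : C1_along (mximg A) (xstar f A).
Proof.
exists (Dmx f A); split=> [|b Ab e e0]; last exact: xstar_remainder.
(* The pseudoinverse is not continuous in general, but here it can be eliminated at every [b], since
   the Hessian is invertible at every point. *)
have -> : Dmx f A = fun b => pinv_factored B CL (Sigma f A b).
  by apply/funext => b; exact: Dmx_factored.
apply/subspace_continuousP => b Ab.
have FF : Filter (within (mximg A) (nbhs b)) := within_filter _ (nbhs_filter b).
apply: (cvg_pinv_factored (FF := FF)) => [|c|]; [exact: form_unit|exact: form_unit|].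
apply: (cvg_invmx (FF := FF)) => [//|c //|].
apply: (@cvg_comp _ _ _ (xstar f A) (hessian f) _ (nbhs (xstar f A b))).
  exact: xstar_cvg.
exact: cH.
Qed.

(** The expansion of [xstar f A] holds only within the image of [A], so the chain rule is carried
    out by hand: the difference quotient is [D *m q h] plus the remainder divided by [h]. *)
Lemma xstar_chain (b : R -> 'cV[R]_m) (t : R) : (forall s, mximg A (b s)) ->
  derivable b t 1 ->
  is_derive t 1 (fun s => xstar f A (b s)) (Dmx f A (b t) *m 'D_1 b t).
Proof.
move=> Ab db; set D := Dmx f A (b t); set x := xstar f A.
set q := fun h : R => h^-1 *: (b (h *: 1 + t) - b t).
have qb : q h @[h --> 0^'] --> 'D_1 b t by exact: db.
(* The curve stays in the image of [A], so its convergence to [b t] is convergence within that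
   subspace. *)
have bt : b (h *: 1 + t) @[h --> 0^'] --> within (mximg A) (nbhs (b t)).
  have cb : {for t, continuous b}.
    by apply: differentiable_continuous; apply/derivable1_diffP.
  have ct : h *: 1 + t @[h --> (0 : R)^'] --> t.
    rewrite -[X in _ --> X]add0r; apply: cvgD; last exact: cvg_cst.
    rewrite -[X in _ --> X](scale0r 1); apply: cvgZr_tmp.
    exact: (@cvg_within _ (nbhs (0 : R))).
  move=> P /(cvg_comp _ _ ct cb) bP.
  have : \forall h \near (0 : R)^', mximg A (b (h *: 1 + t)) -> P (b (h *: 1 + t)).
    exact: bP.
  by apply: (@filterS _ (0 : R)^') => h /(_ (Ab _)).
suff xD : h^-1 *: (x (b (h *: 1 + t)) - x (b t)) @[h --> 0^'] --> D *m 'D_1 b t.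
  by apply: DeriveDef; [apply/cvg_ex; eexists; exact: xD|exact: cvg_lim xD].
pose rem h := x (b (h *: 1 + t)) - x (b t) - D *m (b (h *: 1 + t) - b t).
have -> : (fun h : R => h^-1 *: (x (b (h *: 1 + t)) - x (b t))) =
          (fun h => h^-1 *: rem h + D *m q h).
  by apply/funext => h; rewrite /q -scalemxAr -scalerDr subrK.
rewrite -[D *m 'D_1 b t]add0r; apply: cvgD; last first.
  by apply: cvg_mulmx; [exact: cvg_cst|exact: qb].
(* [M] bounds [q h] for small [h], so tolerance [e / M] in the remainder estimate gives [e] after
   division by [h]. *)
pose M := `|'D_1 b t| + 1; have M0 : 0 < M by rewrite ltr_wpDl.
have /cvgrPdist_le/(_ _ ltr01) q1 := qb.
apply/cvgrPdist_le => e e0.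
have /bt rem_near := xstar_remainder (Ab t) (divr_gt0 e0 M0).
near=> h; rewrite sub0r normrN.
have qM : `|q h| <= M.
  have : `|'D_1 b t - q h| <= 1 by near: h.
  by rewrite distrC => /(le_trans (lerB_dist _ _)); rewrite lerBlDl.
have rem_le : `|rem h| <= e / M * `|b (h *: 1 + t) - b t|.
  by near: h; exact: rem_near.
rewrite normrZ; apply: le_trans (ler_wpM2l (normr_ge0 _) rem_le) _.
rewrite mulrCA -normrZ -/(q h).
by rewrite mulrAC ler_pdivrMr// ler_wpM2l// ltW.
Unshelve. all: by end_near. Qed.

End xstar_derivative.

Theorem theorem1 (R : realType) (n m : nat) (f : 'cV[R]_n -> R)
    (A : 'M[R]_(m, n)) :
  strongly_convex f ->
  twice_continuously_differentiable f ->
  [/\ forall b, mximg A b -> exists! x, argmin f A b x,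
      forall b, mximg A b -> hessian f (xstar f A b) \in unitmx,
      C1_along (mximg A) (xstar f A)
    & forall b : R -> 'cV[R]_m,
        (forall t, mximg A (b t)) ->
        (forall t : R, derivable b t 1) ->
        forall t : R, is_derive t 1 (fun s => xstar f A (b s))
                    (Dmx f A (b t) *m 'D_1 b t)].
Proof.
move=> fc [df dg cH].
have AE : A = col_base A *m row_base A by rewrite mulmx_base.
have uC : (col_base A)^T *m col_base A \in unitmx.
  rewrite -{2}(trmxK (col_base A)); apply: gram_unit.
  by rewrite /row_free mxrank_tr; exact: col_base_full.
set C := col_base A in AE uC.
(* This left inverse of the full-column-rank factor [C] is its pseudoinverse, which makes [C *m CL]
   symmetric. *)
pose CL := invmx (C^T *m C) *m C^T.
have CLK : CL *m C = 1%:M by rewrite /CL -mulmxA mulVmx.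
have C_CLT : (C *m CL)^T = C *m CL.
  by rewrite /CL; clearbody C; rewrite !(trmx_mul, trmx_inv, trmxK) mulmxA.
split.
- move=> b /(strongly_convex_argmin_ex df fc)[x xP]; exists x; split=> // y yP.
  exact: strongly_convex_argmin_uniq fc xP yP.
- by move=> b _; have [mu mu0 fmu] := fc; exact: hessian_unit mu0 fmu df _ (dg _).
- exact: xstar_C1 AE (row_base_free A) CLK C_CLT fc df dg cH.
- move=> b Ab db t.
  by apply: (xstar_chain AE (row_base_free A) CLK C_CLT fc df dg).
Qed.
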